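(* Let $n$ be a positive integer, let $\mathbf{M}=\mathbf{M}(a,t)=(a-t)\cdot\mathbf{I}_{n\times n}+t\cdot\mathbf{1}_{n\times n}$, and put $\lambda_*=a-t$ and $\lambda_{**}=a-t+nt$. For all $a,t\in\mathbb{R}$ the characteristic polynomial of the double-constant matrix $\mathbf{M}$ is $$p(\lambda)\equiv\det(\mathbf{M}-\lambda\cdot\mathbf{I}_{n\times n})=(\lambda_*-\lambda)^{n-1}(\lambda_{**}-\lambda)=(a-t-\lambda)^{n-1}(a-t+nt-\lambda).$$ The eigenvalues of $\mathbf{M}$ are $$\lambda_1=\lambda_{**}=a-t+nt,\qquad \lambda_2=\cdots=\lambda_n=\lambda_*=a-t.$$ In the case where these eigenvalues are non-zero, the corresponding eigenvectors are: for the eigenvalue $\lambda_{**}$, every vector $\mathbf{u}_{**}\propto\mathbf{1}_n$; for the eigenvalue $\lambda_*$, every non-zero vector $\mathbf{u}_*$ with $\mathbf{u}_*\cdot\mathbf{1}_n=0$.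
   Context: $\mathbf{I}_{n\times n}$ is the $n\times n$ identity matrix, $\mathbf{1}_{n\times n}$ is the $n\times n$ matrix all of whose entries equal $1$, and $\mathbf{1}_n$ is the column vector of length $n$ all of whose entries equal $1$. The matrix $\mathbf{M}(a,t)$, called the double-constant matrix, thus has every diagonal entry equal to $a$ and every off-diagonal entry equal to $t$. The symbol $\propto$ means ''is proportional to'' (a scalar multiple of), and $\cdot$ between vectors is the dot product. The eigenvalues $\lambda_1,\ldots,\lambda_n$ are listed with multiplicity.
   Formalization: That the eigenvectors are only the described ones is claimed when λ_* ≠ λ_** (for λ_** also when n = 1), as it fails for t = 0, n ≥ 2, where every non-zero vector is an eigenvector; eigenvectors proportional to 1_n are taken non-zero. *)

(* Defs.v *)
(* MathComp; [R : realType] is an axiomatization of the field of real numbers. *)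
From HB Require Import structures.
From mathcomp Require Import all_boot all_order all_algebra.
From mathcomp Require Import reals.

Set Implicit Arguments.
Unset Strict Implicit.
Unset Printing Implicit Defensive.

Import Order.TTheory GRing.Theory Num.Theory.
Local Open Scope ring_scope.

Definition double_constant (R : realType) (n : nat) (a t : R) : 'M[R]_n :=
  (a - t) *: 1%:M + t *: const_mx 1.

Definition lambda_star (R : realType) (a t : R) : R := a - t.

Definition lambda_starstar (R : realType) (n : nat) (a t : R) : R :=
  a - t + n%:R * t.

Definition ones (R : realType) (n : nat) : 'cV[R]_n := const_mx 1.

Definition dotv (R : realType) (n : nat) (u v : 'cV[R]_n) : R :=
  \sum_i u i 0 * v i 0.

Definition propto (R : realType) (n : nat) (u v : 'cV[R]_n) : Prop :=
  exists c : R, u = c *: v.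

Definition eigenvector (R : realType) (n : nat) (M : 'M[R]_n) (l : R)
    (u : 'cV[R]_n) : Prop :=
  u != 0 /\ M *m u = l *: u.

(* [s] lists the eigenvalues of [M], each repeated according to its algebraic
   multiplicity. The library predicate [eigenvalue] is defined with row vectors
   acting on the left, and [char_poly M] is \det ('X - M) rather than
   \det (M - 'X); neither convention affects the eigenvalues or their
   multiplicities. *)
Definition lists_eigenvalues (R : realType) (n : nat) (M : 'M[R]_n)
    (s : seq R) : Prop :=
  forall x : R,
    (x \in s) = eigenvalue M x /\ count_mem x s = mup x (char_poly M).

(* Main.v *)
Require Import Defs.
From HB Require Import structures.
From mathcomp Require Import all_boot all_order all_algebra.
From mathcomp Require Import reals.
From mathcomp Require Import ring.

Set Implicit Arguments.
Unset Strict Implicit.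
Unset Printing Implicit Defensive.

Import Order.TTheory GRing.Theory Num.Theory.
Local Open Scope ring_scope.

(* Subtracting the first row from the others and then adding all the other
   columns to the first ([L] and [U] below) makes the matrix block upper
   triangular, with x + (m+1) t in the corner and x on the rest of the diagonal.
   No division is needed, so this covers both the determinants over R and, over
   {poly R}, the characteristic polynomial. *)
Lemma det_scalar_add_const (S : comNzRingType) (m : nat) (x t : S) :
  \det (x%:M + const_mx t : 'M_m.+1) = x ^+ m * (x + m.+1%:R * t).
Proof.
rewrite -[m.+1]add1n; set A := (_ + _).
pose L : 'M[S]_(1 + m) := block_mx 1%:M 0 (const_mx (-1)) 1%:M.
pose U : 'M[S]_(1 + m) := block_mx 1%:M 0 (const_mx 1) 1%:M.
have detL : \det L = 1 by rewrite det_lblock !det1 mulr1.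
have detU : \det U = 1 by rewrite det_lblock !det1 mulr1.
have AE : A = block_mx (x + t)%:M (const_mx t) (const_mx t) (x%:M + const_mx t).
  rewrite /A scalar_mx_block -[const_mx t]submxK add_block_mx.
  rewrite add0r add0r; congr block_mx; apply/matrixP=> i j; rewrite !mxE //.
  by rewrite !ord1 !eqxx !mulr1n.
have LAE : L *m A = block_mx (x + t)%:M (const_mx t) (const_mx (- x)) x%:M.
  rewrite AE mulmx_block !mul1mx !mul0mx !addr0; congr block_mx.
    apply/matrixP=> i j; rewrite !mxE big_ord1 !mxE !ord1 eqxx mulr1n; ring.
  apply/matrixP=> i j; rewrite !mxE big_ord1 !mxE; ring.
have LAUE : L *m A *m U = block_mx (x + (1 + m)%:R * t)%:M (const_mx t) 0 x%:M.
  rewrite LAE mulmx_block !mulmx1 !mulmx0 !add0r; congr block_mx.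
    apply/matrixP=> i j; rewrite !mxE (eq_bigr (fun=> t)) => [|k _]; last first.
      by rewrite !mxE mulr1.
    by rewrite sumr_const card_ord !ord1 eqxx !mulr1n -[t *+ m]mulr_natl natrD; ring.
  by rewrite mul_scalar_mx; apply/matrixP=> i j; rewrite !mxE; ring.
have -> : \det A = \det (L *m A *m U).
  by rewrite !det_mulmx detL detU mul1r mulr1.
by rewrite LAUE det_ublock !det_scalar expr1 mulrC.
Qed.

Lemma det_double_constant_sub (R : realType) (m : nat) (a t l : R) :
  \det (double_constant m.+1 a t - l *: 1%:M)
  = (a - t - l) ^+ m * (a - t + m.+1%:R * t - l).
Proof.
have -> : double_constant m.+1 a t - l *: 1%:M = (a - t - l)%:M + const_mx t.
  by apply/matrixP=> i j; rewrite !mxE; case: (i == j); ring.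
by rewrite det_scalar_add_const; congr (_ * _); ring.
Qed.

(** Over [{poly R}] the matrix 'X - M again has the shape scalar plus constant, since its diagonal
    entry 'X - a equals ('X - (a - t)) - t; the determinant formula applies with constant
    [- t%:P]. *)
Lemma char_poly_double_constant (R : realType) (m : nat) (a t : R) :
  char_poly (double_constant m.+1 a t)
  = ('X - (lambda_star a t)%:P) ^+ m * ('X - (lambda_starstar m.+1 a t)%:P).
Proof.
rewrite /char_poly; have -> : char_poly_mx (double_constant m.+1 a t)
    = ('X - (lambda_star a t)%:P)%:M + const_mx (- t%:P).
  apply/matrixP=> i j; rewrite !mxE.
  case: (i == j); rewrite ?mulr1n ?mulr0n /lambda_star.
    by rewrite !(mulr1, rmorphD, rmorphN) /=; ring.
  by rewrite !(mulr1, mulr0, rmorphD, rmorphN, rmorph0) /=; ring.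
rewrite det_scalar_add_const; congr (_ * _).
rewrite /lambda_starstar /lambda_star.
by rewrite !(rmorphD, rmorphN, rmorphM, rmorph_nat) /=; ring.
Qed.

(** Multiplicities are read off the factored characteristic polynomial. They add over the two
    factors, so the case where both eigenvalues coincide needs no separate treatment. *)
Lemma lists_eigenvalues_double_constant (R : realType) (m : nat) (a t : R) :
  lists_eigenvalues (double_constant m.+1 a t)
    (lambda_starstar m.+1 a t :: nseq m (lambda_star a t)).
Proof.
move=> x; rewrite eigenvalue_root_char.
have count_mup :
    count_mem x (lambda_starstar m.+1 a t :: nseq m (lambda_star a t))
    = mup x (char_poly (double_constant m.+1 a t)).
  rewrite char_poly_double_constant mupM ?expf_neq0 ?polyXsubC_eq0 //.
  rewrite -['X - (lambda_starstar _ _ _)%:P]expr1 !mup_XsubCX /= count_nseq addnC.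
  by congr (_ + _)%N; case: ifP => /= ->; rewrite ?mul1n ?mul0n.
(* Membership follows from the count: [x] is listed iff its multiplicity is positive, iff it is a
   root. *)
split=> //; rewrite -has_pred1 has_count count_mup.
by rewrite -XsubC_dvd ?dvdp_XsubCl ?monic_neq0 ?char_poly_monic.
Qed.

(** The all-ones matrix sends [u] to its coordinate sum times [ones]. All four eigenvector claims
    are read off this formula. *)
Lemma double_constant_mul (R : realType) (n : nat) (a t : R) (u : 'cV[R]_n) :
  double_constant n a t *m u
  = lambda_star a t *: u + (t * dotv u (ones R n)) *: ones R n.
Proof.
rewrite mulmxDl -!scalemxAl mul1mx -scalerA; congr (_ + _ *: _).
apply/matrixP=> i j; rewrite !mxE mulr1 ord1; apply: eq_bigr => k _.
by rewrite !mxE mulrC.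
Qed.

Lemma dotv_ones (R : realType) (n : nat) : dotv (ones R n) (ones R n) = n%:R.
Proof.
rewrite /dotv (eq_bigr (fun=> 1)) => [|k _]; last by rewrite !mxE mulr1.
by rewrite sumr_const card_ord.
Qed.

Lemma dotvZl (R : realType) (n : nat) (c : R) (u v : 'cV[R]_n) :
  dotv (c *: u) v = c * dotv u v.
Proof. by rewrite /dotv mulr_sumr; apply: eq_bigr => k _; rewrite !mxE mulrA. Qed.

(** The converse eigenvector claims are guarded because [ls = lss] forces t = 0: then M is scalar
    and every non-zero vector is an eigenvector. *)
Theorem theorem2 (R : realType) (n : nat) (hn : (0 < n)%N) (a t : R) :
  let M := double_constant n a t in
  let ls := lambda_star a t in
  let lss := lambda_starstar n a t in
  [/\ forall l : R,
        \det (M - l *: 1%:M) = (ls - l) ^+ n.-1 * (lss - l) /\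
        \det (M - l *: 1%:M) = (a - t - l) ^+ n.-1 * (a - t + n%:R * t - l),
      lists_eigenvalues M (lss :: nseq n.-1 ls),
      lss != 0 ->
        (forall u : 'cV[R]_n,
           u != 0 -> propto u (ones R n) -> eigenvector M lss u) /\
        (n = 1%N \/ ls != lss ->
           forall u : 'cV[R]_n, eigenvector M lss u -> propto u (ones R n))
    & ls != 0 ->
        (forall u : 'cV[R]_n,
           u != 0 -> dotv u (ones R n) = 0 -> eigenvector M ls u) /\
        (ls != lss ->
           forall u : 'cV[R]_n, eigenvector M ls u -> dotv u (ones R n) = 0)].
Proof.
case: n hn => // m _ M ls lss.
have lssE : lss = ls + m.+1%:R * t by [].
split.
- by move=> l; split; rewrite det_double_constant_sub.
- exact: lists_eigenvalues_double_constant.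
- move=> _; split.
    move=> u u_neq0 [c uE]; split=> //.
    rewrite /M double_constant_mul -/ls lssE uE dotvZl dotv_ones.
    by rewrite !scalerA -scalerDl; congr (_ *: _); ring.
  move=> n1_or_neq u [_]; rewrite /M double_constant_mul -/ls => Mu.
  (* In dimension 1 every vector is a multiple of [ones], its only entry being the factor. *)
  case: n1_or_neq => [[m0] | neq].
    exists (u 0 0); subst m; apply/matrixP=> i j.
    by rewrite !mxE !ord1 mulr1.
  have sub_neq0 : lss - ls != 0 by rewrite subr_eq0 eq_sym.
  (* The factor comes from solving [ls *: u + (t * dotv u ones) *: ones = lss *: u] for [u]. *)
  exists ((lss - ls)^-1 * (t * dotv u (ones R m.+1))).
  apply: (scalerI sub_neq0); rewrite scalerA mulVKf //.
  by rewrite scalerBl -Mu addrC addKr.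
- move=> _; split.
    move=> u u_neq0 u_ones; split=> //.
    by rewrite double_constant_mul u_ones mulr0 scale0r addr0.
  move=> neq u [_]; rewrite /M double_constant_mul -/ls.
  (* Cancelling [ls *: u] leaves a multiple of [ones] equal to 0; one entry gives t * (u . 1) = 0,
     and t = 0 would make the eigenvalues equal. *)
  move/(canRL (addKr _)); rewrite addNr => /matrixP/(_ 0 0).
  rewrite !mxE mulr1 => /eqP; rewrite mulf_eq0 => /orP[/eqP t0|/eqP //].
  by move: neq; rewrite lssE t0 mulr0 addr0 eqxx.
Qed.
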